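(* For every $n\in\mathbb{N}$, there exists a Cantor set $C\subset \mathbb{R}^2$ such that $\dim_{\rm H}(C)=1$ and the pinned $n$-chain distance set $\Delta^n_{y} (C)$ has nonempty interior in $\mathbb{R}^n$ for some $y\in C$.
   Context: A Cantor set is a subset of $\mathbb{R}^d$ that is compact, totally disconnected, and perfect. $\dim_{\rm H}$ is Hausdorff dimension and $|\cdot|$ is the Euclidean norm. For $X\subset\mathbb{R}^2$, $n\in\mathbb{N}$ ($n\ge 1$) and a pin $x\in X$, the pinned $n$-chain distance set is $$\Delta_x^n(X)=\{(|x^0-x^1|,|x^1-x^2|,\dots,|x^{n-1}-x^n|) : x^0=x,\ x^i\in X,\ x^i\neq x^j \text{ for } i\neq j\}\subset\mathbb{R}^n,$$ where $i,j$ range over $\{0,1,\dots,n\}$. *)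

(* Defs.v *)
From HB Require Import structures.
From mathcomp Require Import all_boot all_order all_algebra.
From mathcomp Require Import all_classical all_reals all_analysis.

Set Implicit Arguments.
Unset Strict Implicit.
Unset Printing Implicit Defensive.

Import Order.TTheory GRing.Theory Num.Theory.
Import numFieldNormedType.Exports.

Local Open Scope classical_set_scope.
Local Open Scope ring_scope.

(* The norm `|x| on 'rV[R]_d is the sup norm, whereas distances and diameters
   are Euclidean here.  The two norms induce the same topology, so topological
   notions on 'rV[R]_d are those of the library. *)
Definition enorm (R : realType) (d : nat) (x : 'rV[R]_d) : R :=
  Num.sqrt (\sum_(i < d) x 0 i ^+ 2).

(* The element 0 only matters for E = set0, where ereal_sup would give -oo. *)
Definition ediam (R : realType) (d : nat) (E : set 'rV[R]_d) : \bar R :=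
  ereal_sup ([set 0%E] `|` [set (enorm (x - y))%:E | x in E & y in E]).

(* diam(E)^s, with value 0 on the empty set also for s = 0; otherwise
   0 `^ 0 = 1, so that the case s = 0 gives the counting measure. *)
Definition diam_pow (R : realType) (d : nat) (s : R) (E : set 'rV[R]_d) :
    \bar R :=
  if E == set0 then 0%E else (ediam E `^ s)%E.

(* Finite covers are included, as the U k may be empty. *)
Definition hausdorff_premeasure (R : realType) (d : nat) (s delta : R)
    (E : set 'rV[R]_d) : \bar R :=
  ereal_inf [set (\sum_(k <oo) diam_pow s (U k))%E |
    U in [set U : nat -> set 'rV[R]_d |
      E `<=` \bigcup_k U k /\ forall k, (ediam (U k) <= delta%:E)%E]].

Definition hausdorff_measure (R : realType) (d : nat) (s : R)
    (E : set 'rV[R]_d) : \bar R :=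
  ereal_sup [set hausdorff_premeasure s delta E | delta in [set e : R | 0 < e]].

Definition hausdorff_dim (R : realType) (d : nat) (E : set 'rV[R]_d) : \bar R :=
  ereal_inf [set s%:E |
    s in [set s : R | 0 <= s /\ hausdorff_measure s E = 0%E]].

Definition cantor_set (R : realType) (d : nat) (C : set 'rV[R]_d) : Prop :=
  [/\ compact C, totally_disconnected C & perfect_set C].

(* For i < n, widen_ord (leqnSn n) i and lift ord0 i are the elements of
   'I_n.+1 with values i and i + 1. *)
Definition pinned_chain_dist (R : realType) (n : nat) (X : set 'rV[R]_2)
    (x : 'rV[R]_2) : set 'rV[R]_n :=
  [set t | exists p : 'I_n.+1 -> 'rV[R]_2,
    [/\ p ord0 = x,
        forall i, X (p i),
        forall i j, i != j -> p i != p j &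
        t = \row_(i < n)
              enorm (p (widen_ord (leqnSn n) i) - p (lift ord0 i))]].

(* Main.v *)
Require Import Defs.
From mathcomp Require Import all_boot all_order all_algebra.
From mathcomp Require Import all_classical all_reals all_analysis.
From mathcomp Require Import lra ring zify.
Import Order.TTheory GRing.Theory Num.Theory.
Import numFieldNormedType.Exports.
Local Open Scope classical_set_scope.
Local Open Scope ring_scope.

(** Every binary sequence w is sent to a point staircase w of the plane.  Up to
    a shift of the height that depends on the digit w 0 only, its abscissa is
    the sum of the w k / 3 ^ k and its height the sum of the w k / 2 ^ k.
    The set C of these points consists of two translates of the part of the
    graph of a Cantor function that lies above a Cantor set, the one with
    w 0 = 1 to the lower right of the one with w 0 = 0.  As the image of the
    Cantor space under a continuous injection, C is a Cantor set.

    Dimension.  The sequences with given first k digits, k > 0, are sent to a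
    set of diameter at most 4 / 2 ^ k, and there are 2 ^ k such sets, so that
    the s-dimensional measure of C vanishes for s > 1.  Conversely, the first
    coordinate of a chain is the distance to the pin, a 1-Lipschitz function
    on C; as soon as its values fill an interval, C has dimension at least 1.

    Distances.  Let x be a point of the lower right piece, and look at the
    distance D to x on the upper left piece.  There D decreases with the
    abscissa and increases with the height.  Between the neighbouring codes
    u0111... and u1000... the height stays the same and the abscissa jumps to
    the right, so D cannot jump up when the sequences are run through in
    lexicographic order.  Hence D takes every value between those at u000...
    and at u111... on the sequences that begin with u, although C is totally
    disconnected (digit_intermediate_value).  The box that contains these
    points is at least as tall as it is wide and lies well above x, so these
    two values are distinct, and by continuity a fixed interval of radii works
    for all x near a given point (pinned_distance_stable).  The two pieces play
    symmetric roles, since exchanging the digits 0 and 1 is a point reflection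
    of C.  So radii can be prescribed along a path that alternates between the
    two pieces, each of its points staying near a given one
    (pinned_chain_stable); choosing these points distinct gives an open set of
    chains. *)

(** * Binary sequences *)

Definition agree (k : nat) (v w : nat -> bool) :=
  forall i, (i < k)%N -> v i = w i.

Definition fill (k : nat) (v : nat -> bool) (b : bool) : nat -> bool :=
  fun i => if (i < k)%N then v i else b.

(** The codes v = u0111... and w = u1000..., with u of length k, which are
    consecutive in the lexicographic order. *)
Definition adjacent (k : nat) (v w : nat -> bool) :=
  [/\ agree k v w, v k = false, w k = true &
    forall i, (k < i)%N -> v i = true /\ w i = false].

Definition set_digit (k : nat) (v : nat -> bool) (b : bool) : nat -> bool :=
  fun i => if i == k then b else v i.

Lemma agree_trans k u v w : agree k u v -> agree k v w -> agree k u w.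
Proof. by move=> uv vw i ik; rewrite uv ?vw. Qed.

Lemma agree_sym k u v : agree k u v -> agree k v u.
Proof. by move=> uv i ik; rewrite uv. Qed.

Lemma agree_leq k l u v : (k <= l)%N -> agree l u v -> agree k u v.
Proof. by move=> kl uv i ik; rewrite uv// (leq_trans ik). Qed.

Lemma fill_agree k v b : agree k (fill k v b) v.
Proof. by move=> i ik; rewrite /fill ik. Qed.

Lemma set_digit_agree k v b : agree k (set_digit k v b) v.
Proof. by move=> i ik; rewrite /set_digit ltn_eqF. Qed.

Lemma fill_set_digit k v b : fill k.+1 (set_digit k v b) b = fill k v b.
Proof.
apply/funext => i; rewrite /fill /set_digit ltnS leq_eqVlt.
by case: eqP => //= ->; rewrite ltnn.
Qed.

(** A continuous function of binary sequences that never jumps up between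
    adjacent codes takes all the values between those at u000... and u111... on
    the sequences that begin with u.  A value r bracketed by the two extreme
    continuations of a prefix u is also bracketed by those of u0 or of u1:
    either r <= D (u0111...), or D (u1000...) <= D (u0111...) < r.  Iterating
    this choice produces the digits of a point with value r. *)
Lemma digit_intermediate_value {R : realType} (D : (nat -> bool) -> R) (m : nat)
    (u : nat -> bool) (r : R) :
  (forall e, 0 < e -> exists k, forall v w, agree k v w -> `|D v - D w| < e) ->
  (forall k v w, (m <= k)%N -> agree m v u -> adjacent k v w -> D w <= D v) ->
  D (fill m u false) <= r <= D (fill m u true) ->
  exists w, agree m w u /\ D w = r.
Proof.
move=> Dcont Dgap Dr.
(* The state s j holds the m + j digits chosen so far; the next digit is 1
   exactly when the lower half only has values below r. *)
pose next k v :=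
  set_digit k v (D (fill k.+1 (set_digit k v false) true) < r).
pose fix s j := if j is j'.+1 then next (m + j')%N (s j') else u.
have sS j : agree (m + j) (s j.+1) (s j) by exact: set_digit_agree.
have s_mono i j : (i <= j)%N -> agree (m + i) (s j) (s i).
  elim: j => [|j IH]; first by rewrite leqn0 => /eqP ->.
  rewrite leq_eqVlt => /predU1P[-> //|]; rewrite ltnS => ij.
  by apply: agree_trans (IH ij); apply: agree_leq (sS j); rewrite leq_add2l.
have su j : agree m (s j) u by have := s_mono 0%N j isT; rewrite addn0.
have s_bracket j :
    D (fill (m + j) (s j) false) <= r <= D (fill (m + j) (s j) true).
  elim: j => [|j IH]; first by rewrite addn0.
  rewrite addnS /= /next; case: ltP => [ltr|ler]; rewrite fill_set_digit.
    case/andP: IH => _ ->; rewrite andbT; apply: le_trans (ltW ltr).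
    apply: (Dgap (m + j)%N) => //; first exact: leq_addr.
      apply: agree_trans (su j); apply: agree_leq (leq_addr j m) _.
      apply: agree_trans (set_digit_agree _ _ false).
      by apply: agree_leq (fill_agree _ _ _).
    split; [|by rewrite /fill /set_digit ltnSn eqxx..|].
    - move=> i ij; rewrite /fill /set_digit ltnS (ltnW ij).
      by rewrite ltn_eqF.
    - by move=> i ji; rewrite /fill ltnS leqNgt ji.
  by case/andP: IH => -> _; rewrite ler.
pose w i := s i.+1 i.
have ws j : agree (m + j) w (s j).
  move=> i imj; rewrite /w; case: (leqP j i.+1) => [ji|ij].
    exact: s_mono.
  by apply/esym/(s_mono _ _ (ltnW ij)); lia.
exists w; split; first by have := ws 0%N; rewrite addn0.
apply/eqP; rewrite eq_le; apply/andP; split; apply/ler_addgt0Pl => e e0.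
- have [k Dk] := Dcont e e0.
  have /Dk : agree k w (fill (m + k) (s k) false).
    apply: agree_leq (leq_addl m k) _.
    by apply: agree_trans (ws k) (agree_sym _ _ _ (fill_agree _ _ _)).
  by case/andP: (s_bracket k) => + _; rewrite ltr_norml; lra.
- have [k Dk] := Dcont e e0.
  have /Dk : agree k w (fill (m + k) (s k) true).
    apply: agree_leq (leq_addl m k) _.
    by apply: agree_trans (ws k) (agree_sym _ _ _ (fill_agree _ _ _)).
  by case/andP: (s_bracket k) => _; rewrite ltr_norml; lra.
Qed.

(** * Numbers written with the digits 0 and 1 *)

Definition digit_sum {R : realType} (q : R) (w : nat -> bool) : R :=
  limn (series (fun k => (w k)%:R * q ^+ k)).

Section DigitSum.
Context {R : realType} (q : R).
Hypotheses (q0 : 0 <= q) (q1 : q < 1).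
Implicit Types (v w : nat -> bool) (k : nat).

Lemma is_cvg_digit_series w :
  cvgn (series (fun k => (w k)%:R * q ^+ k : R)).
Proof.
apply: (@series_le_cvg _ _ (geometric 1 q)) => [k|k|k|].
- by rewrite mulr_ge0// exprn_ge0.
- by rewrite /= mul1r exprn_ge0.
- by rewrite /=; case: (w k); rewrite ?mul0r ?mul1r// exprn_ge0.
- by apply: is_cvg_geometric_series; rewrite ger0_norm.
Qed.

Lemma digit_sumS w : digit_sum q w = (w 0)%:R + q * digit_sum q (w \o S).
Proof.
apply: cvg_lim => //; rewrite -(cvg_shiftn 1) /=.
rewrite (_ : (fun n => _) =
  fun n => (w 0%N)%:R + q * series (fun k => ((w \o S) k)%:R * q ^+ k) n).
  apply: cvgD; first exact: cvg_cst.
  by apply: cvgMl_tmp; exact: is_cvg_digit_series.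
apply/funext => n; rewrite addn1 /series /= big_nat_recl//= expr0 mulr1.
congr (_ + _); rewrite big_distrr /=; apply: eq_bigr => i _.
by rewrite exprS mulrCA.
Qed.

Lemma digit_sum_ge0 w : 0 <= digit_sum q w.
Proof.
apply: limr_ge; first exact: is_cvg_digit_series.
by apply: nearW => n; apply: sumr_ge0 => i _; rewrite mulr_ge0// exprn_ge0.
Qed.

Lemma digit_sum_le w : digit_sum q w <= (1 - q)^-1.
Proof.
have gq : `|q| < 1 by rewrite ger0_norm.
rewrite -[leRHS]mul1r -(cvg_lim _ (@cvg_geometric_series R 1 q gq))//.
apply: ler_lim; [exact: is_cvg_digit_series|exact: is_cvg_geometric_series|].
apply: nearW => n; apply: ler_sum => i _ /=; rewrite mul1r.
by case: (w i); rewrite ?mul1r// mul0r exprn_ge0.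
Qed.

Lemma digit_sum_agree k v w : agree k v w ->
  digit_sum q v - digit_sum q w =
  q ^+ k * (digit_sum q (fun i => v (k + i)%N) -
            digit_sum q (fun i => w (k + i)%N)).
Proof.
elim: k v w => [|k IH] v w vw; first by rewrite expr0 mul1r.
rewrite digit_sumS (digit_sumS w) vw// opprD addrACA subrr add0r -mulrBr.
by rewrite (IH (v \o S) (w \o S)) ?exprS ?mulrA// => i ik; exact: vw.
Qed.

Lemma dist_digit_sum k v w : agree k v w ->
  `|digit_sum q v - digit_sum q w| <= q ^+ k * (1 - q)^-1.
Proof.
move=> /digit_sum_agree ->; rewrite normrM ger0_norm ?exprn_ge0//.
rewrite ler_wpM2l ?exprn_ge0// ler_norml.
have := digit_sum_ge0 (fun i => v (k + i)%N).
have := digit_sum_ge0 (fun i => w (k + i)%N).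
have := digit_sum_le (fun i => v (k + i)%N).
have := digit_sum_le (fun i => w (k + i)%N).
lra.
Qed.

Lemma digit_sum_false w : (forall i, w i = false) -> digit_sum q w = 0.
Proof.
move=> w0; have := digit_sumS w.
rewrite (_ : w \o S = w) ?w0; last by apply/funext => i /=; rewrite !w0.
move=> h; apply/eqP; have : (1 - q) * digit_sum q w = 0.
  by rewrite mulrBl mul1r {1}h mulr0n add0r subrr.
by move/eqP; rewrite mulf_eq0 subr_eq0 gt_eqF.
Qed.

Lemma digit_sumN w : digit_sum q (negb \o w) = (1 - q)^-1 - digit_sum q w.
Proof.
have gq : `|q| < 1 by rewrite ger0_norm.
apply/cvg_lim => //.
rewrite (_ : series _ = (fun n => series (geometric 1 q) n -
    series (fun k => (w k)%:R * q ^+ k : R) n)).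
  apply: cvgB; last exact: is_cvg_digit_series.
  by rewrite -[_^-1]mul1r; exact: cvg_geometric_series.
apply/funext => n; rewrite /series /= -sumrB; apply: eq_bigr => i _.
by case: (w i); rewrite /= ?mul1r ?mul0r ?subrr ?subr0.
Qed.

Lemma digit_sum_true w : (forall i, w i = true) -> digit_sum q w = (1 - q)^-1.
Proof.
move=> wT; rewrite -[RHS]subr0 -(digit_sum_false xpred0)//.
rewrite -digit_sumN.
by congr digit_sum; apply/funext => i; rewrite wT.
Qed.

Lemma digit_sum_fill k v :
  digit_sum q (fill k v true) - digit_sum q (fill k v false) =
  q ^+ k * (1 - q)^-1.
Proof.
rewrite (digit_sum_agree k); last first.
  exact: agree_trans (fill_agree _ _ _) (agree_sym _ _ _ (fill_agree _ _ _)).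
rewrite digit_sum_true; last by move=> i; rewrite /fill ltnNge leq_addr.
rewrite digit_sum_false ?subr0// => i.
by rewrite /fill ltnNge leq_addr.
Qed.

(** The right-hand side vanishes for q = 1 / 2, where adjacent codes denote the
    same number, and is positive for q = 1 / 3, where they bound a gap of the
    Cantor set. *)
Lemma digit_sum_adjacent k v w : adjacent k v w ->
  digit_sum q w - digit_sum q v = q ^+ k * (1 - q / (1 - q)).
Proof.
move=> [vw vk wk tl]; rewrite (digit_sum_agree k); last exact: agree_sym.
congr (_ * _); rewrite (digit_sumS (fun i => w (k + i)%N)).
rewrite (digit_sumS (fun i => v (k + i)%N)) addn0 vk wk.
rewrite digit_sum_false ?mulr0 ?addr0; last first.
  by move=> i; apply: (proj2 (tl _ _)); rewrite /= addnS ltnS leq_addr.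
rewrite digit_sum_true ?add0r//.
by move=> i; apply: (proj1 (tl _ _)); rewrite /= addnS ltnS leq_addr.
Qed.

(** For q < 1 / 2 the first digit that differs outweighs all the later ones. *)
Lemma digit_sum_lt k v w : 0 < q -> q < 2^-1 -> agree k v w ->
  v k = false -> w k = true -> digit_sum q v < digit_sum q w.
Proof.
move=> qp q2 vw vk wk; rewrite -subr_gt0 (digit_sum_agree k).
  2: exact: agree_sym.
rewrite mulr_gt0 ?exprn_gt0//.
rewrite (digit_sumS (fun i => w (k + i)%N)).
rewrite (digit_sumS (fun i => v (k + i)%N)) addn0 vk wk /= add0r.
have := digit_sum_ge0 ((fun i => w (k + i)%N) \o S).
have := digit_sum_le ((fun i => v (k + i)%N) \o S).
set b := digit_sum q _; set a := digit_sum q _ => b1 a0.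
have : q * b <= q * (1 - q)^-1 by rewrite ler_pM2l.
have : q / (1 - q) < 1 by rewrite ltr_pdivrMr ?subr_gt0//; lra.
have : 0 <= q * a by rewrite mulr_ge0.
lra.
Qed.

Lemma digit_sum_inj : 0 < q -> q < 2^-1 -> injective (digit_sum q).
Proof.
move=> qp q2 v w vw; apply/funext => i; apply/eqP/negPn/negP => vwi.
have [k vwk kmin] := ex_minnP (ex_intro (fun i => v i != w i) i vwi).
have agr : agree k v w.
  by move=> j jk; apply/eqP/negPn/negP => /kmin; rewrite leqNgt jk.
move: vwk; case vk : (v k); case wk : (w k) => // _.
- have := digit_sum_lt _ _ _ qp q2 (agree_sym _ _ _ agr) wk vk.
  by rewrite vw ltxx.
- by have := digit_sum_lt _ _ _ qp q2 agr vk wk; rewrite vw ltxx.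
Qed.

End DigitSum.

(** * The Euclidean norm *)

Section EuclideanNorm.
Context {R : realType} {d : nat}.
Implicit Types x y : 'rV[R]_d.

Lemma enorm_ge0 x : 0 <= enorm x.
Proof. exact: sqrtr_ge0. Qed.

Lemma sqr_enorm x : enorm x ^+ 2 = \sum_i x 0 i ^+ 2.
Proof. by rewrite sqr_sqrtr// sumr_ge0// => i _; rewrite sqr_ge0. Qed.

Lemma coord_le_enorm x i : `|x 0 i| <= enorm x.
Proof.
rewrite -sqrtr_sqr ler_wsqrtr// (bigD1 i)//= lerDl sumr_ge0// => j _.
exact: sqr_ge0.
Qed.

Lemma enormN x : enorm (- x) = enorm x.
Proof. by congr Num.sqrt; apply: eq_bigr => i _; rewrite mxE sqrrN. Qed.

Lemma enormC x y : enorm (x - y) = enorm (y - x).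
Proof. by rewrite -enormN opprB. Qed.

Lemma enorm_eq0 x : enorm x = 0 -> x = 0.
Proof.
move=> x0; have := sqr_enorm x; rewrite x0 expr0n /= => /esym/psumr_eq0P s0.
apply/rowP => i; rewrite mxE; apply/eqP; rewrite -sqrf_eq0 s0// => j _.
exact: sqr_ge0.
Qed.

(** Cauchy-Schwarz: expand the nonnegative squared norm of
    |y| *: x - |x| *: y. *)
Lemma enorm_dot_le x y : \sum_i x 0 i * y 0 i <= enorm x * enorm y.
Proof.
have [/enorm_eq0 ->|x0] := eqVneq (enorm x) 0.
  rewrite big1 ?mulr_ge0 ?enorm_ge0// => i _.
  by rewrite mxE mul0r.
have [/enorm_eq0 ->|y0] := eqVneq (enorm y) 0.
  rewrite big1 ?mulr_ge0 ?enorm_ge0// => i _.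
  by rewrite mxE mulr0.
have xy0 : 0 < enorm x * enorm y.
  by rewrite mulr_gt0// lt_neqAle eq_sym ?x0 ?y0 enorm_ge0.
have : 0 <= \sum_i (enorm y * x 0 i - enorm x * y 0 i) ^+ 2.
  by apply: sumr_ge0 => i _; exact: sqr_ge0.
have -> : \sum_i (enorm y * x 0 i - enorm x * y 0 i) ^+ 2 =
    enorm y ^+ 2 * (\sum_i x 0 i ^+ 2) + enorm x ^+ 2 * (\sum_i y 0 i ^+ 2) -
    2 * (enorm x * enorm y) * \sum_i x 0 i * y 0 i.
  rewrite !mulr_sumr -big_split /= -sumrB; apply: eq_bigr => i _; ring.
rewrite -!sqr_enorm => h; rewrite -(ler_pM2l xy0); move: h; lra.
Qed.

Lemma enormD x y : enorm (x + y) <= enorm x + enorm y.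
Proof.
rewrite -(@ler_pXn2r _ 2)// ?nnegrE ?addr_ge0 ?enorm_ge0//.
rewrite sqr_enorm sqrrD !sqr_enorm.
rewrite [leLHS](_ : _ = \sum_i x 0 i ^+ 2 + (\sum_i x 0 i * y 0 i) *+ 2 +
    \sum_i y 0 i ^+ 2); last first.
  rewrite -sumrMnl -!big_split /=; apply: eq_bigr => i _; rewrite mxE sqrrD//.
by rewrite lerD2r lerD2l lerMn2r enorm_dot_le orbT.
Qed.

Lemma dist_enormB y x x' : `|enorm (y - x) - enorm (y - x')| <= enorm (x - x').
Proof.
have h a b : enorm (y - a) <= enorm (y - b) + enorm (a - b).
  by rewrite (enormC a b); apply: le_trans (enormD _ _); rewrite addrA subrK.
by rewrite ler_norml; have := h x x'; have := h x' x; rewrite (enormC x'); lra.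
Qed.

End EuclideanNorm.

Section Plane.
Context {R : realType}.
Implicit Types x : 'rV[R]_2.

Lemma enorm2 x : enorm x = Num.sqrt (x 0 0 ^+ 2 + x 0 1 ^+ 2).
Proof.
congr Num.sqrt; rewrite big_ord_recl big_ord1.
by congr (_ + x _ _ ^+ 2); apply: val_inj.
Qed.

Lemma enorm2_le x : enorm x <= `|x 0 0| + `|x 0 1|.
Proof.
rewrite enorm2 -[leRHS]ger0_norm ?addr_ge0// -sqrtr_sqr ler_wsqrtr//.
by rewrite sqrrD !real_normK ?num_real// lerD2r lerDl mulrn_wge0// mulr_ge0.
Qed.
End Plane.

(** * The double staircase *)

Section Staircase.
Context {R : realType}.
Implicit Types (v w z : nat -> bool).

(** The pieces with w 0 = 0 and w 0 = 1 lie in the rectangles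
    [0, 1/2] x [0, 1] and [1, 3/2] x [-3, -2].  With the drop of 4, the second
    piece lies so far below the first one that a step up takes a point of the
    first piece away from the second by more than an equally long step to the
    right brings it closer (staircase_corner_lt). *)
Definition staircase w : 'rV[R]_2 :=
  \row_i (if i == 0 then digit_sum 3^-1 w
          else digit_sum 2^-1 w - 4 * (w 0%N)%:R).

Lemma dist_staircaseE v w : enorm (staircase v - staircase w) =
  Num.sqrt ((digit_sum 3^-1 v - digit_sum 3^-1 w) ^+ 2 +
    (digit_sum 2^-1 v - 4 * (v 0%N)%:R -
     (digit_sum 2^-1 w - 4 * (w 0%N)%:R)) ^+ 2).
Proof. by rewrite enorm2 !mxE. Qed.

Let t0 : 0 <= 3^-1 :> R. Proof. by lra. Qed.
Let t1 : 3^-1 < 1 :> R. Proof. by lra. Qed.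
Let h0 : 0 <= 2^-1 :> R. Proof. by lra. Qed.
Let h1 : 2^-1 < 1 :> R. Proof. by lra. Qed.
Let tV : (1 - 3^-1)^-1 = 3 / 2 :> R. Proof. by field. Qed.
Let hV : (1 - 2^-1)^-1 = 2 :> R. Proof. by field. Qed.

Lemma dist_staircase_agree k v w : (0 < k)%N -> agree k v w ->
  enorm (staircase v - staircase w) <= 4 * 2^-1 ^+ k.
Proof.
move=> k0 vw; apply: le_trans (enorm2_le _) _; rewrite !mxE /= vw//.
rewrite (_ : forall a b c : R, a - c - (b - c) = a - b); last by move=> *; ring.
have := dist_digit_sum _ t0 t1 _ _ _ vw.
have := dist_digit_sum _ h0 h1 _ _ _ vw.
have : (3^-1 : R) ^+ k <= 2^-1 ^+ k by rewrite lerXn2r ?nnegrE//; lra.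
have : 0 <= (2^-1 : R) ^+ k by rewrite exprn_ge0.
rewrite tV hV; lra.
Qed.

(** Exchanging the digits is a point reflection, which swaps the two pieces. *)
Lemma dist_staircase_negb v w :
  enorm (staircase (negb \o v) - staircase (negb \o w)) =
  enorm (staircase v - staircase w).
Proof.
rewrite !dist_staircaseE /= !(digit_sumN _ h0 h1) !(digit_sumN _ t0 t1).
by congr Num.sqrt; case: (v 0%N) (w 0%N) => -[] /=; ring.
Qed.

Lemma staircase_pieces_separated w v : w 0%N = true -> v 0%N = false ->
  digit_sum 3^-1 v + 2^-1 <= digit_sum 3^-1 w :> R /\
  digit_sum 2^-1 w - 4 <= digit_sum 2^-1 v - 2 :> R.
Proof.
move=> w0 v0; rewrite (digit_sumS _ t0 t1 v) (digit_sumS _ t0 t1 w).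
rewrite (digit_sumS _ h0 h1 v) (digit_sumS _ h0 h1 w) w0 v0 /=.
have := digit_sum_ge0 _ t0 t1 (w \o S); have := digit_sum_le _ t0 t1 (v \o S).
have := digit_sum_ge0 _ h0 h1 (v \o S); have := digit_sum_le _ h0 h1 (w \o S).
rewrite tV hV; lra.
Qed.

(** The points of v and w have the same height, and that of w is further to the
    right, hence closer to the lower right piece. *)
Lemma dist_staircase_adjacent z k v w :
  z 0%N = true -> (0 < k)%N -> v 0%N = false -> adjacent k v w ->
  enorm (staircase z - staircase w) <= enorm (staircase z - staircase v).
Proof.
move=> z0 k0 v0 vw.
have := digit_sum_adjacent _ t0 t1 _ _ _ vw.
have := digit_sum_adjacent _ h0 h1 _ _ _ vw.
rewrite tV hV (_ : 1 - 2^-1 * 2 = 0 :> R) ?mulr0; last by field.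
move=> /eqP; rewrite subr_eq0 => /eqP bE aE.
have w0 : w 0%N = false by case: vw => vw _ _ _; rewrite -vw.
rewrite !dist_staircaseE bE v0 w0 ler_wsqrtr// lerD2r.
have [zw _] := staircase_pieces_separated _ _ z0 w0.
have : 0 <= (3^-1 : R) ^+ k * (1 - 3^-1 * (3 / 2)).
  by rewrite mulr_ge0 ?exprn_ge0//; lra.
by move=> ?; rewrite ler_pXn2r ?nnegrE//; lra.
Qed.

(** The two points are opposite corners of a box of width 3/2 * 3 ^- k and
    height 2 * 2 ^- k.  Its lower left corner is at most 3/2 to the left of
    staircase z and at least 2 above it, so that passing to the upper right
    corner increases the squared distance by at least
    2 * 2 * (2 * 2 ^- k) - 2 * (3/2) * (3/2 * 3 ^- k) > 0. *)
Lemma staircase_corner_lt z w k : z 0%N = true -> w 0%N = false -> (0 < k)%N ->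
  enorm (staircase z - staircase (fill k w false)) <
  enorm (staircase z - staircase (fill k w true)).
Proof.
move=> z0 w0 k0.
have := digit_sum_fill _ t0 t1 k w; have := digit_sum_fill _ h0 h1 k w.
have f0 b : fill k w b 0%N = false by rewrite /fill k0.
have [za zb] := staircase_pieces_separated _ _ z0 (f0 false).
have [za' zb'] := staircase_pieces_separated _ _ z0 (f0 true).
have ht : (3^-1 : R) ^+ k <= 2^-1 ^+ k by rewrite lerXn2r ?nnegrE//; lra.
have tp : 0 < (3^-1 : R) ^+ k by rewrite exprn_gt0; lra.
have zle := digit_sum_le _ t0 t1 z.
have pge := digit_sum_ge0 _ t0 t1 (fill k w false).
rewrite tV hV in zle * => bE aE; rewrite !dist_staircaseE z0 !f0 ltr_sqrt.
  2: by apply: ltr_wpDl; [exact: sqr_ge0|rewrite exprn_even_gt0//=; lra].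
move: bE aE zb zb' za za' zle pge ht tp.
set aP := digit_sum 3^-1 (fill k w false).
set aQ := digit_sum 3^-1 (fill k w true).
set bP := digit_sum 2^-1 (fill k w false).
set bQ := digit_sum 2^-1 (fill k w true).
set az := digit_sum 3^-1 z; set bz := digit_sum 2^-1 z.
set h := 2^-1 ^+ k; set t := 3^-1 ^+ k.
move=> bE aE zb zb' za za' zle pge ht tp.
have {aE za'}-> : aQ = aP + t * (3 / 2) by rewrite -aE; ring.
have {bE zb'}-> : bQ = bP + h * 2 by rewrite -bE; ring.
have hB : 0 <= h * (bP + 2 - bz) by rewrite mulr_ge0//; lra.
have tA : 0 <= t * (3 / 2 - (az - aP)) by rewrite mulr_ge0//; lra.
have hh := sqr_ge0 h; have tt := sqr_ge0 t.
rewrite -subr_gt0.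
rewrite [ltRHS](_ : _ = 4 * (h * (bP + 2 - bz)) + 4 * h ^+ 2 + 8 * h
  + 3 * (t * (3 / 2 - (az - aP))) + 9 / 4 * t ^+ 2 - 9 / 2 * t).
  lra.
by rewrite /=; field.
Qed.

Lemma staircase_inj : injective staircase.
Proof.
move=> v w /rowP/(_ 0); rewrite !mxE; apply: digit_sum_inj => //; lra.
Qed.

End Staircase.

(** * Chains of prescribed distances *)

Section Chain.
Context {R : realType}.
Local Notation pt := (@staircase R).
Implicit Types (v w z u : nat -> bool).

Lemma near_geometric_lt (c q e : R) : 0 <= q < 1 -> 0 < e ->
  \forall k \near \oo, c * q ^+ k < e.
Proof.
move=> /andP[q0 q1] e0; have : (fun k => c * q ^+ k) @ \oo --> c * 0.
  by apply: cvgMl_tmp; apply: cvg_expr; rewrite ger0_norm.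
rewrite mulr0 => /cvgrPdist_lt /(_ e e0); apply: filterS => k.
by rewrite /= sub0r normrN; apply: le_lt_trans; exact: ler_norm.
Qed.

Lemma small_scale (e : R) : 0 < e -> exists2 k, (0 < k)%N & 4 * 2^-1 ^+ k < e.
Proof.
move=> e0; near \oo => k; exists k; near: k; first exact: nbhs_infty_gt.
by apply: near_geometric_lt => //; lra.
Unshelve. all: by end_near. Qed.

(** If z and u lie in different pieces, then all the points near that of z see a
    common interval of distances to the points of C near that of u.  The radius
    r0 is the mean of the distances from z to the two extreme points whose codes
    begin with the m first digits of u; the distances from nearby points to
    these two bracket all the radii near r0. *)
Lemma pinned_distance_stable z u m : z 0%N != u 0%N -> (0 < m)%N ->
  exists m' (r0 delta : R), [/\ (0 < m')%N, 0 < delta &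
    forall w r, agree m' w z -> `|r - r0| < delta ->
      exists2 w', agree m w' u & enorm (pt w - pt w') = r].
Proof.
wlog z0 : z u / z 0%N = true => [hw zu m0|].
  have [z0|z0] := boolP (z 0%N); first exact: hw.
  have [|||m' [r0 [delta [m'0 d0 hr]]]] := hw (negb \o z) (negb \o u) => //=.
  - by case: (z 0%N) (u 0%N) zu => -[].
  exists m', r0, delta; split => // w r wz rr0.
  have [|w' w'u wr] := hr (negb \o w) r _ rr0.
    by move=> i im /=; rewrite wz.
  exists (negb \o w'); first by move=> i im /=; rewrite w'u//= negbK.
  rewrite -wr -(dist_staircase_negb w); congr (enorm (_ - pt _)).
  by apply/funext => i /=; rewrite negbK.
rewrite z0 => u0 m0; have {}u0 : u 0%N = false by case: (u 0%N) u0.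
have := @staircase_corner_lt R z u m z0 u0 m0.
set dP := enorm _; set dQ := enorm _ => PQ.
have [m' m'0 hm'] : exists2 k, (0 < k)%N & 4 * 2^-1 ^+ k < (dQ - dP) / 4.
  by apply: small_scale; lra.
exists m', ((dP + dQ) / 2), ((dQ - dP) / 4); split; [by []|lra|].
move=> w r wz rr0; have w0 : w 0%N = true by rewrite wz.
have wzd : enorm (pt w - pt z) < (dQ - dP) / 4.
  by apply: le_lt_trans (dist_staircase_agree _ _ _ m'0 wz) hm'.
have near_z x : `|enorm (pt w - x) - enorm (pt z - x)| < (dQ - dP) / 4.
  by rewrite !(enormC _ x); apply: le_lt_trans (dist_enormB _ _ _) wzd.
have [|||w' [w'u <-]] := @digit_intermediate_value R
  (fun v => enorm (pt w - pt v)) m u r; last by exists w'.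
- move=> e e0; have [k k0 ke] := small_scale _ e0.
  exists k => v v' vv'; apply: le_lt_trans (dist_enormB _ _ _) _.
  exact: le_lt_trans (dist_staircase_agree _ _ _ k0 vv') ke.
- move=> k v v' mk vu vv'; apply: (dist_staircase_adjacent _ k) => //.
  + exact: leq_trans m0 mk.
  + by rewrite vu.
- have := near_z (pt (fill m u false)); have := near_z (pt (fill m u true)).
  rewrite -/dP -/dQ; move: rr0; rewrite !ltr_norml.
  move=> /andP[? ?] /andP[? ?] /andP[? ?]; apply/andP; split; lra.
Qed.

(** Chaining pinned_distance_stable from the last step back to the first: the
    neighbourhood of each point in which the rest of the chain can be
    completed is the target of the previous step.  Keeping each p i near the
    given z i is what later makes the points of the chain distinct. *)
Lemma pinned_chain_stable n (z : nat -> nat -> bool) m :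
  (forall i, z i 0%N != z i.+1 0%N) -> (0 < m)%N ->
  exists m' (r0 : nat -> R) (delta : R), [/\ (m <= m')%N, 0 < delta &
    forall w (r : nat -> R), agree m' w (z 0%N) ->
      (forall i, (i < n)%N -> `|r i - r0 i| < delta) ->
      exists p : nat -> nat -> bool, [/\ p 0%N = w,
        forall i, (i <= n)%N -> agree m (p i) (z i) &
        forall i, (i < n)%N -> enorm (pt (p i) - pt (p i.+1)) = r i]].
Proof.
move=> + m0; elim: n z => [|n IH] z zalt.
  exists m, (fun=> 0), 1; split => // w r wz _; exists (fun=> w); split => //.
  by move=> i; rewrite leqn0 => /eqP ->.
have [m1 [r1 [d1 [mm1 d10 h1]]]] := IH (fun i => z i.+1) (fun i => zalt i.+1).
have m10 := leq_trans m0 mm1.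
have [m2 [r2 [d2 [m20 d20 h2]]]] := pinned_distance_stable _ _ _ (zalt 0%N) m10.
exists (maxn m m2), (fun i => if i is j.+1 then r1 j else r2), (Num.min d1 d2).
split; [exact: leq_maxl|by rewrite lt_min d10|].
move=> w r wz hr.
have [|w' w'z w'r] := h2 w (r 0%N) (agree_leq _ _ _ _ (leq_maxr _ _) wz).
  by have := hr 0%N isT; rewrite lt_min => /andP[].
have [|p [p0 pz pr]] := h1 w' (fun i => r i.+1) w'z.
  by move=> i i_n; have := hr i.+1 i_n; rewrite lt_min => /andP[].
exists (fun i => if i is j.+1 then p j else w); split => //.
- move=> [_|i]; last exact: pz.
  exact: agree_leq (leq_maxl _ _) wz.
- by move=> [_|i]; [rewrite p0|exact: pr].
Qed.

Lemma interior_pinned_chain_staircase n :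
  exists2 y, range pt y & interior (@pinned_chain_dist R n (range pt) y) !=set0.
Proof.
(* The parity of i decides the piece of z i, and the digit i + 1 tells z i from
   the other sequences; the first n + 2 digits show both for i <= n. *)
pose z i j := if j is j'.+1 then j' == i else odd i.
have [||m' [r0 [delta [mm' d0 h]]]] := pinned_chain_stable n z n.+2 => //.
  by move=> i /=; case: odd.
exists (pt (z 0%N)); first by exists (z 0%N).
exists (\row_(i < n) r0 i); apply/nbhs_ballP; exists delta => //= t t_near.
pose r i := oapp (fun j : 'I_n => t 0 j) 0 (insub i).
have rE (i : 'I_n) : r i = t 0 i.
  by rewrite /r insubT //= => ?; congr (t _ _); apply: val_inj.
have [//|i i_n|p [p0 pz pr]] := h (z 0%N) r.
  have := (proj2 t_near) ord0 (Ordinal i_n).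
  by rewrite -(rE (Ordinal i_n)) mxE /ball /= distrC.
exists (fun i : 'I_n.+1 => pt (p i)); split.
- by rewrite p0.
- by move=> i; exists (p i).
- move=> i j ij; apply/eqP => pij.
  have iin := ltn_ord i; have jin := ltn_ord j.
  have ii : p i i.+1 = true by rewrite pz//= eqxx.
  have jj : p j i.+1 = (i == j :> nat) by rewrite pz.
  move: jj; rewrite -(staircase_inj _ _ pij) ii => /esym/eqP/val_inj/eqP.
  by rewrite (negPf ij).
- by apply/rowP => i; rewrite mxE -rE -pr//.
Qed.
End Chain.

(** * Topology of the double staircase *)

Section CantorImage.
Context {T U : topologicalType} (f : T -> U).
Hypotheses (Tcompact : compact [set: T]) (Uhaus : hausdorff_space U).
Hypotheses (fcont : continuous f) (finj : injective f).

Lemma closed_image (A : set T) : closed A -> closed (f @` A).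
Proof.
move=> cA; apply: compact_closed => //; apply: continuous_compact.
  exact/continuous_subspaceT.
exact: subclosed_compact cA Tcompact _.
Qed.

Lemma compact_range : compact (range f).
Proof.
by apply: continuous_compact => //; exact/continuous_subspaceT.
Qed.

(** A clopen set that separates two points of T and its complement have disjoint
    closed images, so no connected part of the range contains both images. *)
Lemma totally_disconnected_range :
  zero_dimensional T -> totally_disconnected (range f).
Proof.
move=> T0 _ [x _ <-]; apply/seteqP; split => [p|_ ->]; last first.
  by apply: connected_component_refl; exists x.
move=> Kp; have [y _ yp] := connected_component_sub Kp; rewrite -yp in Kp *.
apply: contrapT => /= yx.
have : x != y by apply/eqP => xy; apply: yx; rewrite xy.
move=> /T0[V [[oV cV] Vx Vy]].
have cVf : closed (f @` V) by exact: closed_image.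
have cVCf : closed (f @` (~` V)) by apply: closed_image; exact: open_closedC.
have disj : f @` V `&` f @` (~` V) = set0.
  by rewrite -subset0 => _ [[a Va <-] [b Vb /finj ba]]; apply: Vb; rewrite ba.
have sepV : separated (f @` V) (f @` (~` V)).
  by split; rewrite -?(closure_id _).1.
have [|KV|KV] := connected_subset sepV _
    (@component_connected _ (range f) (f x)).
- apply: subset_trans (@connected_component_sub _ _ _) _ => _ [a _ <-].
  by have [Va|Va] := pselect (V a); [left|right]; exists a.
- by have [a Va /finj ay] := KV _ Kp; apply: Vy; rewrite -ay.
- have [|a Va /finj ax] := KV (f x); last by apply: Va; rewrite ax.
  by apply: connected_component_refl; exists x.
Qed.

Lemma perfect_range : perfect_set [set: T] -> perfect_set (range f).
Proof.
move=> [_ Tlim]; split; first exact: closed_image _ closedT.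
apply/seteqP; split => [p|_ [x _ <-] V /fcont fV].
  move=> /subset_limit_point; rewrite -(closure_id _).1//.
  exact: closed_image _ closedT.
have : limit_point [set: T] x by rewrite Tlim.
move=> /(_ _ fV)[y [yx _ Vy]]; exists (f y); split => //.
by apply: contra_neq yx; exact: finj.
Qed.

End CantorImage.

Lemma near_agree (w : cantor_space) k : \forall v \near w, agree k v w.
Proof.
elim: k => [|k IH]; first by near=> v.
have hk : \forall v \near w, v k = w k.
  apply: (@proj_continuous _ (fun=> bool) k w [set w k]).
  exact: discrete_set1.
near=> v; move=> i; rewrite ltnS leq_eqVlt => /predU1P[->|].
  by near: v.
by move: i; near: v.
Unshelve. all: by end_near. Qed.

Lemma staircase_continuous {R : realType} :
  continuous (@staircase R : cantor_space -> 'rV[R]_2).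
Proof.
move=> w; apply/cvg_ballP => e e0.
have [k k0 ke] := @small_scale R e e0.
near=> v; split => // i j; rewrite /ball /= ord1.
have vw : agree k v w by near: v; exact: near_agree.
have := coord_le_enorm (staircase w - staircase v : 'rV[R]_2) j.
rewrite !mxE => h; apply: le_lt_trans h _; apply: le_lt_trans ke.
exact: dist_staircase_agree k0 (agree_sym _ _ _ vw).
Unshelve. all: by end_near. Qed.

Lemma cantor_set_staircase (R : realType) : cantor_set (range (@staircase R)).
Proof.
pose f : cantor_space -> 'rV[R]_2 := @staircase R.
have [pT cT _ zT] := cantor_like_cantor_space.
have hU : hausdorff_space 'rV[R]_2 by exact: norm_hausdorff.
split.
- exact: (compact_range f cT staircase_continuous).
- exact: (totally_disconnected_range f cT hU staircase_continuous
            staircase_inj zT).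
- exact: (perfect_range f cT hU staircase_continuous staircase_inj pT).
Qed.

(** * Hausdorff dimension *)

Section HausdorffDimension.
Context {R : realType} {d : nat}.
Implicit Types (E U : set 'rV[R]_d) (s r : R).

Lemma ediam_ge0 E : (0 <= ediam E)%E.
Proof. by apply: ereal_sup_ubound; left. Qed.

Lemma ediam_le E r : 0 <= r ->
  (forall x y, E x -> E y -> enorm (x - y) <= r) -> (ediam E <= r%:E)%E.
Proof.
move=> r0 Er; apply: ge_ereal_sup => _ [->|[x Ex [y Ey <-]]]; rewrite lee_fin//.
exact: Er.
Qed.

Lemma enorm_le_ediam E x y : E x -> E y -> ((enorm (x - y))%:E <= ediam E)%E.
Proof.
by move=> Ex Ey; apply: ereal_sup_ubound; right; exists x => //; exists y.
Qed.

Lemma diam_pow_ge0 s E : (0 <= diam_pow s E)%E.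
Proof. by rewrite /diam_pow; case: ifP => // _; exact: poweR_ge0. Qed.

Lemma diam_pow_le s E r : 0 <= s -> 0 <= r ->
  (forall x y, E x -> E y -> enorm (x - y) <= r) ->
  (diam_pow s E <= (r `^ s)%:E)%E.
Proof.
move=> s0 r0 /(ediam_le _ _ r0) Er; rewrite /diam_pow; case: ifP => _.
  by rewrite lee_fin powR_ge0.
rewrite -poweR_EFin; apply: gt0_ler_poweR => //.
- by rewrite in_itv /= ediam_ge0 leey.
- by rewrite in_itv /= lee_fin r0 leey.
Qed.

Lemma hausdorff_premeasure_ge0 s r E : (0 <= hausdorff_premeasure s r E)%E.
Proof.
apply: le_ereal_inf_tmp => _ [U _ <-]; apply: nneseries_ge0 => k _ _.
exact: diam_pow_ge0.
Qed.

Lemma hausdorff_measure_eq0 s E : 0 <= s ->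
  (forall e, 0 < e -> exists N r (U : nat -> set 'rV[R]_d),
    [/\ 0 <= r <= e, N%:R * r `^ s <= e, E `<=` \bigcup_(k < N) U k &
      forall k x y, U k x -> U k y -> enorm (x - y) <= r]) ->
  hausdorff_measure s E = 0%E.
Proof.
move=> s0 Ecov; apply/eqP; rewrite eq_le; apply/andP; split; last first.
  apply: le_trans (hausdorff_premeasure_ge0 s 1 E) _.
  by apply: ereal_sup_ubound; exists 1 => //=.
apply: ge_ereal_sup => _ [r0 /= r00 <-]; apply/lee_addgt0Pr => e e0.
rewrite add0e; have m0 : 0 < Num.min r0 e by rewrite lt_min r00.
have [N [r [U [/andP[rge0]]]]] := Ecov _ m0.
rewrite !le_min => /andP[rr0 _] /andP[_ Nre] EU Udiam.
pose V k := if (k < N)%N then U k else set0.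
have Vdiam k x y : V k x -> V k y -> enorm (x - y) <= r.
  by rewrite /V; case: ifP => // _; exact: Udiam.
apply: le_trans (_ : \sum_(k <oo) diam_pow s (V k) <= _)%E.
  apply: ereal_inf_lbound; exists V => //; split => [x /EU[k /= kN Ukx]|k].
    by exists k => //; rewrite /V kN.
  by apply: le_trans (ediam_le _ _ rge0 (Vdiam k)) _; rewrite lee_fin.
apply: lime_le; first by apply: is_cvg_nneseries => k _ _; exact: diam_pow_ge0.
exists N => // n /= Nn; rewrite (big_cat_nat (leq0n N) Nn)//=.
rewrite [X in (_ + X)%E]big_nat_cond [X in (_ + X)%E]big1 ?adde0; last first.
  move=> i /andP[/andP[Ni _] _]; rewrite /V ltnNge Ni /=.
  by rewrite /diam_pow eqxx.
apply: (@le_trans _ _ (\sum_(0 <= k < N) (r `^ s)%:E)%E).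
  by apply: lee_sum => k _; exact: diam_pow_le (Vdiam k).
by rewrite sumEFin lee_fin sumr_const_nat subn0 -mulr_natl.
Qed.

Lemma hausdorff_dim_le s E :
  0 <= s -> (forall e, 0 < e -> hausdorff_measure (s + e) E = 0%E) ->
  (hausdorff_dim E <= s%:E)%E.
Proof.
move=> s0 Es; apply/lee_addgt0Pr => e e0; apply: ereal_inf_lbound.
by exists (s + e); [split; [rewrite addr_ge0// ltW|exact: Es]|rewrite EFinD].
Qed.

(** The image of U under f is contained in an interval of length at most the
    diameter r of U, and r <= r `^ s as r <= 1 and s <= 1. *)
Lemma lipschitz_image_interval (f : 'rV[R]_d -> R) s U :
  (forall x y, `|f x - f y| <= enorm (x - y)) ->
  0 <= s <= 1 -> (ediam U <= 1%:E)%E ->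
  exists J : interval R, f @` U `<=` [set` J] /\
    (lebesgue_measure ([set` J] : set R) <= diam_pow s U)%E.
Proof.
move=> flip /andP[s0 s1] U1; have [->|/set0P[x0 Ux0]] := eqVneq U set0.
  exists `]0, 0[; rewrite image_set0; split; first exact: sub0set.
  by rewrite lebesgue_measure_itv /= ltxx diam_pow_ge0.
have [r rE] : exists r, ediam U = r%:E.
  have : ediam U \is a fin_num.
    by rewrite ge0_fin_numE ?ediam_ge0// (le_lt_trans U1)// ltry.
  by move=> /fineK <-; eexists.
have r0 : 0 <= r by rewrite -lee_fin -rE ediam_ge0.
have r1 : r <= 1 by rewrite -lee_fin -rE.
have fU x y : U x -> U y -> f x <= f y + r.
  move=> Ux Uy; rewrite addrC -lerBlDr; apply: le_trans (ler_norm _) _.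
  apply: le_trans (flip _ _) _; rewrite -lee_fin -rE.
  exact: enorm_le_ediam.
have lbU : has_lbound (f @` U).
  by exists (f x0 - r) => _ [x Ux <-]; rewrite lerBlDr fU.
have ubU : has_ubound (f @` U).
  by exists (f x0 + r) => _ [x Ux <-]; rewrite fU.
have fU0 : f @` U !=set0 by exists (f x0), x0.
exists `[inf (f @` U), sup (f @` U)]; split.
  by move=> y fy; rewrite /= in_itv /= ge_inf// ub_le_sup.
have sup_inf : sup (f @` U) <= inf (f @` U) + r.
  apply: ge_sup => // _ [x Ux <-]; rewrite -lerBlDr; apply: lb_le_inf => //.
  by move=> _ [y Uy <-]; rewrite lerBlDr fU.
rewrite /diam_pow ifF; last by apply/negbTE/set0P; exists x0.
rewrite rE poweR_EFin; apply: (@le_trans _ _ r%:E).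
  rewrite lebesgue_measure_itv /=; case: ifP => _; last by rewrite lee_fin.
  by rewrite lee_fin lerBlDr addrC.
rewrite lee_fin; have [->|rn0] := eqVneq r 0; first exact: powR_ge0.
have rp : 0 < r by rewrite lt_neqAle eq_sym rn0.
by rewrite -[leLHS]powRr1//; apply: ger_powR => //; rewrite rp.
Qed.

(** For s < 1, the sum of the diam(U k) `^ s over a cover by sets of diameter at
    most 1 is at least the total length of intervals covering ]a, b[. *)
Lemma hausdorff_dim_ge1 (f : 'rV[R]_d -> R) E (a b : R) :
  (forall x y, `|f x - f y| <= enorm (x - y)) -> a < b ->
  `]a, b[ `<=` f @` E -> (1 <= hausdorff_dim E)%E.
Proof.
move=> flip ab abE; apply: le_ereal_inf_tmp => _ [s [s0 Es] <-].
rewrite lee_fin leNgt; apply/negP => s1.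
have s01 : 0 <= s <= 1 by rewrite s0 ltW.
suff : ((b - a)%:E <= hausdorff_premeasure s 1 E)%E.
  apply/negP; rewrite -ltNge; apply: (@le_lt_trans _ _ 0%E); last first.
    by rewrite lte_fin subr_gt0.
  by rewrite -Es; apply: ereal_sup_ubound; exists 1 => //=.
apply: le_ereal_inf_tmp => _ [U [EU U1] <-].
have /choice[J hJ] k := lipschitz_image_interval _ _ _ flip s01 (U1 k).
apply: (@le_trans _ _ (\sum_(k <oo) lebesgue_measure ([set` J k] : set R))%E).
  have -> : (b - a)%:E = lebesgue_measure (`]a, b[%classic : set R).
    by rewrite lebesgue_measure_itv /= lte_fin ab.
  apply: measure_sigma_subadditive => // x /abE[p /EU[k _ Ukp] <-].
  by exists k => //; apply: (proj1 (hJ k)); exists p.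
apply: lee_nneseries => [k _ _|k _]; first exact: measure_ge0.
exact: (proj2 (hJ k)).
Qed.

End HausdorffDimension.

(** The first coordinate of a chain is the distance from y to a point of X. *)
Lemma hausdorff_dim_pinned_chain (R : realType) (n : nat) (X : set 'rV[R]_2)
    (y : 'rV[R]_2) :
  (1 <= n)%N -> interior (@pinned_chain_dist R n X y) !=set0 ->
  (1 <= hausdorff_dim X)%E.
Proof.
case: n => // n _ [t /nbhs_ballP[e /= e0 te]].
apply: (@hausdorff_dim_ge1 R 2 (fun x => enorm (y - x)) X
  (t 0 0 - e) (t 0 0 + e)).
- by move=> x x'; exact: dist_enormB.
- lra.
move=> r /=; rewrite in_itv /= => /andP[r1 r2].
pose t' := \row_j (if j == 0 then r else t 0 j).
have /te[p [p0 pX pinj /rowP/(_ 0)]] : ball t e t'.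
  split => // i j; rewrite ord1 mxE /ball /=; case: eqP => [->|_].
    by rewrite ltr_norml; lra.
  by rewrite subrr normr0.
rewrite !mxE /= (_ : widen_ord _ 0 = ord0) ?p0; last exact: val_inj.
by move=> ->; exists (p (lift ord0 0)).
Qed.

(** The 2 ^ k sets of points with given first k digits have diameter at most
    4 * 2 ^- k, and 2 ^ k * (4 * 2 ^- k) `^ (1 + e) is
    4 `^ (1 + e) * (2^-1 `^ e) ^+ k, which tends to 0. *)
Lemma hausdorff_measure_staircase (R : realType) (e : R) : 0 < e ->
  hausdorff_measure (1 + e) (range (@staircase R)) = 0%E.
Proof.
move=> e0; apply: hausdorff_measure_eq0; first lra.
move=> eta eta0.
have q1 : 0 <= (2^-1 : R) `^ e < 1.
  have one : 1 `^ e = 1 :> R by rewrite powR1.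
  rewrite powR_ge0 /= -[ltRHS]one.
  by apply: gt0_ltr_powR; rewrite ?nnegrE//; lra.
have [k k0 [k1 k2]] : exists2 k, (0 < k)%N &
    4 * 2^-1 ^+ k < eta /\ 4 `^ (1 + e) * ((2^-1 : R) `^ e) ^+ k < eta.
  near \oo => k; exists k; last split; near: k.
  - exact: nbhs_infty_gt.
  - by apply: near_geometric_lt => //; lra.
  - exact: near_geometric_lt.
(* The covering sets are numbered by the ranks of the tuples of first digits. *)
pose c (w : nat -> bool) : 'I_#|{: {ffun 'I_k -> bool}}| :=
  enum_rank [ffun i : 'I_k => w i].
exists (2 ^ k)%N, (4 * 2^-1 ^+ k).
exists (fun j => @staircase R @` [set w | c w = j :> nat]).
split.
- by rewrite (ltW k1) andbT mulr_ge0// exprn_ge0.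
- apply: le_trans (ltW k2).
  have -> : (4 * 2^-1 ^+ k : R) `^ (1 + e) =
      4 `^ (1 + e) * (2^-1 * 2^-1 `^ e) ^+ k.
    rewrite powRM ?exprn_ge0// -[in LHS]powR_mulrn// powRAC.
    rewrite powR_mulrn ?powR_ge0// (@powRD _ 2^-1) ?powRr1//.
    by apply/implyP => _; rewrite invr_neq0.
  rewrite mulrCA natrX exprMn [2 ^+ k * _]mulrA -exprMn.
  by rewrite mulfV// expr1n mul1r.
- move=> _ [w _ <-]; exists (c w); last by exists w.
  by rewrite /= (leq_trans (ltn_ord _))// card_ffun card_bool card_ord.
- move=> j _ _ [w wj <-] [v vj <-]; apply: dist_staircase_agree => // i ik.
  have /enum_rank_inj/ffunP/(_ (Ordinal ik)) : c w = c v.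
    by apply: val_inj; rewrite /= wj vj.
  by rewrite !ffunE.
Unshelve. all: by end_near. Qed.

Theorem corollary2p5 (R : realType) (n : nat) (n_ge1 : (1 <= n)%N) :
  exists C : set 'rV[R]_2,
    [/\ cantor_set C,
        hausdorff_dim C = 1%:E &
        exists2 y : 'rV[R]_2, C y & interior (@pinned_chain_dist R n C y) !=set0].
Proof.
have [y Cy Dy] := @interior_pinned_chain_staircase R n.
exists (range (@staircase R)).
split; [exact: cantor_set_staircase| |by exists y].
apply/eqP; rewrite eq_le (hausdorff_dim_pinned_chain _ _ _ _ n_ge1 Dy) andbT.
by apply: hausdorff_dim_le => // e; exact: hausdorff_measure_staircase.
Qed.
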